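(* Consider the discrete system $$u_t=-u+\frac{u^2}{v},\qquad 0=d^2n^2\,\mathcal L v-v+u^2$$ on the cycle graph with $n$ nodes, and a $K$-spike solution of it with spikes at $x_1,\dots,x_K$ whose leading-order profile for $n\gg1$ is $u(x_k)=v(x_k)\sim nV_k$, $u(x)\sim 0$ for $x\notin\{x_1,\dots,x_K\}$, and $v(x)\sim\sum_{j=1}^K nV_j^2\,G^{per}(x,x_j)$. Here $V_1,\dots,V_K>0$ satisfy, to leading order, $V_k=\sum_{j=1}^K V_j^2G_{kj}$ for $k=1,\dots,K$, with $G_{kj}=G^{per}(x_k,x_j)$. Let $I$ be the $K\times K$ identity matrix and let $M$ be the $K\times K$ matrix with entries $M_{kj}=2V_jG_{kj}$. Then, in the limit $n\gg1$, the $K$-spike solution is stable when the eigenvalues of the matrix $I-M$ have no positive real parts.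
   Context: The nodes of the cycle graph are identified with the points $x=j/n$ of the circle $\mathbb R/\mathbb Z$, and $\mathcal L$ is the finite-difference Laplacian $(\mathcal L v)(x)=v(x+\tfrac1n)+v(x-\tfrac1n)-2v(x)$. The parameter $d$ is positive. A $K$-spike solution is a steady state with $u(x_k)=v(x_k)>0$ at the $K$ distinct spike locations $x_1,\dots,x_K$ and $u=0$ at all other nodes. The periodic Green's function is $$G^{per}(x,y)=\frac{\cosh\big((l-\tfrac12)/d\big)}{2d\,\sinh\big(1/(2d)\big)},\qquad l=\min(|x-y|,1-|x-y|).$$ Stability refers to the linearization: perturbing a steady state $(u_s,v_s)$ by $u=u_s+e^{\lambda t}\phi$, $v=v_s+e^{\lambda t}\psi$ with $\phi,\psi$ small gives the eigenvalue problem $$\lambda\phi=-\phi+\frac{2u_s}{v_s}\phi-\frac{u_s^2}{v_s^2}\psi,\qquad 0=d^2n^2\mathcal L\psi-\psi+2u_s\phi,$$ and the steady state is stable when there is no eigenvalue $\lambda$ with positive real part.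
   Formalization: If I−M has an eigenvalue with zero real part, exact stability for large n can fail (e.g. two opposite spikes with cosh(1/(2d))=3), so there only stability to leading order is claimed (real parts eventually at most any ε>0); otherwise exact stability for all large n. *)

(* Defs.v *)
From HB Require Import structures.
From mathcomp Require Import all_boot all_order all_algebra.
From mathcomp Require Import all_classical all_reals all_analysis.
From mathcomp Require Import complex.

Set Implicit Arguments.
Unset Strict Implicit.
Unset Printing Implicit Defensive.

Import Order.TTheory GRing.Theory Num.Theory.
Import numFieldNormedType.Exports.

Local Open Scope classical_set_scope.
Local Open Scope ring_scope.
Local Open Scope complex_scope.

(* Node j of the n-cycle is j : 'I_n, sitting at the point j/n of R/Z;
   [ordS] and [ord_pred] are its two (cyclic) neighbours. *)
Definition node_pos (R : realType) (n : nat) (i : 'I_n) : R := i%:R / n%:R.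

(* Over an arbitrary zmodType, so that it acts on both real and complex
   functions on the nodes. *)
Definition laplacian (A : zmodType) (n : nat) (f : 'I_n -> A) (i : 'I_n) : A :=
  f (ordS i) + f (ord_pred i) - f i *+ 2.

Definition coshR (R : realType) (t : R) : R := (expR t + expR (- t)) / 2.
Definition sinhR (R : realType) (t : R) : R := (expR t - expR (- t)) / 2.

(* Points of R/Z are represented in [0, 1[. *)
Definition circle_dist (R : realType) (x y : R) : R :=
  Num.min `|x - y| (1 - `|x - y|).

Definition Gper (R : realType) (d x y : R) : R :=
  coshR ((circle_dist x y - 1 / 2) / d) / (2 * d * sinhR (1 / (2 * d))).

Definition steady_state (R : realType) (d : R) (n : nat) (u v : 'I_n -> R) :=
  forall i : 'I_n,
    0 = - u i + u i ^+ 2 / v i /\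
    0 = d ^+ 2 * n%:R ^+ 2 * laplacian v i - v i + u i ^+ 2.

(* The spikes sit at the nodes p k. The second equation and the discrete
   maximum principle force v > 0 everywhere as soon as there is a spike, so
   u ^+ 2 / v is never a division by zero. *)
Definition spike_solution (R : realType) (d : R) (n K : nat)
    (p : 'I_K -> 'I_n) (u v : 'I_n -> R) :=
  [/\ injective p,
      steady_state d u v,
      forall k : 'I_K, u (p k) = v (p k) /\ 0 < u (p k)
    & forall i : 'I_n, (forall k : 'I_K, i != p k) -> u i = 0].

Definition linearized_eigenvalue (R : realType) (d : R) (n : nat)
    (u v : 'I_n -> R) (lam : R[i]) :=
  exists phi psi : 'I_n -> R[i],
    (exists i : 'I_n, (phi i != 0) || (psi i != 0)) /\
    forall i : 'I_n,
      lam * phi i = - phi i + (2 * u i / v i)%:C * phi i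
                    - (u i ^+ 2 / v i ^+ 2)%:C * psi i /\
      0 = (d ^+ 2 * n%:R ^+ 2)%:C * laplacian psi i - psi i
          + (2 * u i)%:C * phi i.

Definition stable (R : realType) (d : R) (n : nat) (u v : 'I_n -> R) :=
  forall lam : R[i], linearized_eigenvalue d u v lam -> complex.Re lam <= 0.

(* The regime n >> 1 is a family of solutions, indexed by m, on cycles with
   N m nodes, N m --> +oo. As the nodes vary with m, the spike nodes p m k are
   only required to approach the location x k on the circle. The profile of v
   is asymptotic in ratio, uniformly over the nodes. *)
Definition leading_order_profile (R : realType) (d : R) (K : nat)
    (x V : 'I_K -> R) (N : nat -> nat) (p : forall m, 'I_K -> 'I_(N m))
    (u v : forall m, 'I_(N m) -> R) :=
  [/\ forall k : 'I_K,
        circle_dist (node_pos R (p m k)) (x k) @[m --> \oo] --> (0 : R),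
      forall k : 'I_K,
        u m (p m k) / ((N m)%:R * V k) @[m --> \oo] --> (1 : R)
    & forall e : R, 0 < e -> \forall m \near \oo, forall i : 'I_(N m),
        `| v m i / (\sum_(j < K)
             (N m)%:R * V j ^+ 2 * Gper d (node_pos R i) (x j)) - 1 | < e].

(* No eigenvalue has positive real part to leading order as m --> +oo, i.e.
   the supremum of the real parts has a limsup <= 0. *)
Definition stable_to_leading_order (R : realType) (d : R) (N : nat -> nat)
    (u v : forall m, 'I_(N m) -> R) :=
  forall e : R, 0 < e -> \forall m \near \oo,
    forall lam : R[i], linearized_eigenvalue d (u m) (v m) lam ->
      complex.Re lam <= e.

Definition Mmx (R : realType) (d : R) (K : nat) (x V : 'I_K -> R) : 'M[R]_K :=
  \matrix_(k, j) (2 * V j * Gper d (x k) (x j)).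

Definition complex_eigenvalue (R : realType) (K : nat) (A : 'M[R]_K)
    (z : R[i]) : bool :=
  eigenvalue (map_mx (real_complex R) A) z.

(* Main.v *)
Require Import Defs.
From HB Require Import structures.
From mathcomp Require Import all_boot all_order all_algebra.
From mathcomp Require Import all_classical all_reals all_analysis.
From mathcomp Require Import complex.
From mathcomp Require Import perm ring lra.

Set Implicit Arguments.
Unset Strict Implicit.
Unset Printing Implicit Defensive.

Import Order.TTheory GRing.Theory Num.Theory.
Import numFieldNormedType.Exports.

Local Open Scope classical_set_scope.
Local Open Scope ring_scope.

(** Up to [-1], the spectrum is that of a [K x K] matrix. Away from the spikes
[u] vanishes, so there the first linearized equation reads
[lam * phi = - phi]: either [lam = -1], which is harmless, or [phi] lives on the
spikes. The Laplacian being self-adjoint, the second equation is solved by the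
discrete Green's function [dgreen] of the cycle,
[psi k = \sum_i dgreen i k * 2 * u i * phi i] ([dgreen_repr]); since [u = v] at a
spike, [lam] is then an eigenvalue of the [K x K] matrix
[1%:M - (2 * u (p j) * dgreen (p j) (p k))_(k, j)]
([linearized_eigenvalue_spike]).

This matrix converges to [1%:M - Mmx d x V] ([cvg_spike_mx]). The reason is that
[dgreen] is explicit: it is proportional to
[coshR (a * (`|i - k| - n / 2))], where the rate [a] satisfies
[sinhR (a / 2) = 1 / (2 * d * n)], so that [n * a] tends to [1 / d] and
[n * dgreen] to [Gper] ([cvg_dgreen]).

Finally eigenvalues depend continuously on the matrix
([eigenvalue_perturbation]): if [B] is close to [A] and [lam] is an eigenvalue of
[B], then [lam] is bounded and [\det (lam%:M - A)] is close to
[\det (lam%:M - B) = 0]; as the former is the product of the distances from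
[lam] to the eigenvalues of [A], one of these distances is small. Applied to
a tolerance [e] this bounds the real parts by [e]; when no eigenvalue of the limit
is on the imaginary axis, a tolerance below their distance to that axis makes the
real parts nonpositive. *)

(** * Self-adjointness of the Laplacian *)

Lemma laplacian_self_adjoint (A : comPzRingType) (n : nat) (f g : 'I_n -> A) :
  \sum_i laplacian f i * g i = \sum_i f i * laplacian g i.
Proof.
rewrite /laplacian.
under eq_bigr do rewrite mulrBl mulrDl.
under [RHS]eq_bigr do rewrite mulrBr mulrDr.
rewrite !sumrB !big_split /= [in RHS]addrC.
congr (_ + _ - _).
- rewrite [RHS](reindex_inj (can_inj (@ordSK n))) /=.
  by apply: eq_bigr => i _; rewrite ordSK.
- rewrite [RHS](reindex_inj (can_inj (@ord_predK n))) /=.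
  by apply: eq_bigr => i _; rewrite ord_predK.
- by apply: eq_bigr => i _; rewrite mulrnAl mulrnAr.
Qed.

(** * Hyperbolic functions *)

Lemma coshRN (R : realType) (t : R) : coshR (- t) = coshR t.
Proof. by rewrite /coshR opprK addrC. Qed.

Lemma coshRDB (R : realType) (a b : R) :
  coshR (a + b) + coshR (a - b) = 2 * coshR b * coshR a.
Proof. by rewrite /coshR !opprD !opprK !expRD; field. Qed.

Lemma coshRB (R : realType) (a b : R) :
  coshR (a - b) = coshR a * coshR b - sinhR a * sinhR b.
Proof. by rewrite /coshR /sinhR !opprD !opprK !expRD; field. Qed.

Lemma sinhR_gt0 (R : realType) (t : R) : 0 < t -> 0 < sinhR t.
Proof. by move=> t0; rewrite divr_gt0// subr_gt0 ltr_expR; lra. Qed.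

Lemma sinhR_double (R : realType) (a : R) :
  sinhR (2 * a) = 2 * sinhR a * coshR a.
Proof. by rewrite mulr2n mulrDl mul1r /sinhR /coshR !opprD !expRD; field. Qed.

Lemma coshR_double (R : realType) (a : R) :
  coshR (2 * a) = 1 + 2 * sinhR a ^+ 2.
Proof.
rewrite mulr2n mulrDl mul1r /sinhR /coshR !opprD !expRD expRN.
by field; rewrite gt_eqF ?expR_gt0.
Qed.

(** Inverse hyperbolic sine; see [asinhRK]. *)
Definition asinhR (R : realType) (s : R) : R := ln (s + Num.sqrt (1 + s ^+ 2)).

Lemma expR_asinhR (R : realType) (s : R) :
  expR (asinhR s) = s + Num.sqrt (1 + s ^+ 2) /\
  expR (- asinhR s) = Num.sqrt (1 + s ^+ 2) - s.
Proof.
have s1 : 0 <= 1 + s ^+ 2 by nra.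
have q0 := sqrtr_ge0 (1 + s ^+ 2); have qE := sqr_sqrtr s1.
have r0 : 0 < s + Num.sqrt (1 + s ^+ 2) by nra.
rewrite expRN /asinhR lnK //; split=> //.
by apply/(mulfI (lt0r_neq0 r0)); rewrite divff ?gt_eqF//; nra.
Qed.

Lemma asinhRK (R : realType) (s : R) : sinhR (asinhR s) = s.
Proof. by rewrite /sinhR !(expR_asinhR s).1 !(expR_asinhR s).2; field. Qed.

Lemma coshR_asinhR (R : realType) (s : R) :
  coshR (asinhR s) = Num.sqrt (1 + s ^+ 2).
Proof. by rewrite /coshR !(expR_asinhR s).1 !(expR_asinhR s).2; field. Qed.

(** From [1 + t <= expR t] at [t = asinhR s] and at [t = - asinhR s]. *)
Lemma asinhR_near_id (R : realType) (s : R) : `|asinhR s - s| <= s ^+ 2.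
Proof.
have := expR_ge1Dx (asinhR s); have := expR_ge1Dx (- asinhR s).
rewrite !(expR_asinhR s).1 !(expR_asinhR s).2.
have s1 : 0 <= 1 + s ^+ 2 by nra.
have q0 := sqrtr_ge0 (1 + s ^+ 2); have qE := sqr_sqrtr s1.
have q1 : Num.sqrt (1 + s ^+ 2) <= 1 + s ^+ 2 by nra.
by rewrite ler_norml => *; apply/andP; split; lra.
Qed.

Lemma continuous_coshR (R : realType) : continuous (@coshR R).
Proof.
move=> t; apply: cvgMr_tmp; apply: cvgD; first exact: continuous_expR.
apply: (@continuous_comp R R R -%R expR); first exact: oppr_continuous.
exact: continuous_expR.
Qed.

Lemma continuous_sinhR (R : realType) : continuous (@sinhR R).
Proof.
move=> t; apply: cvgMr_tmp; apply: cvgB; first exact: continuous_expR.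
apply: (@continuous_comp R R R -%R expR); first exact: oppr_continuous.
exact: continuous_expR.
Qed.

Lemma cvg_asinhR_ratio (R : realType) (s : nat -> R) :
  (forall m, 0 < s m) -> s m @[m --> \oo] --> (0 : R) ->
  asinhR (s m) / s m @[m --> \oo] --> (1 : R).
Proof.
move=> s0 scvg.
apply: (@squeeze_cvgr _ _ _ _ (fun m => 1 - s m) (fun m => 1 + s m)).
- apply: nearW => m; have := asinhR_near_id (s m); rewrite ler_norml.
  have sm := s0 m; rewrite ler_pdivlMr // ler_pdivrMr // => /andP[h1 h2].
  by apply/andP; split; nra.
- by rewrite -[X in _ --> X]subr0; apply: cvgB => //; exact: cvg_cst.
- by rewrite -[X in _ --> X]addr0; apply: cvgD => //; exact: cvg_cst.
Qed.

(** * The discrete Green's function of the cycle *)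

(** The exponent [a] for which [expR (a * l)] and [expR (- a * l)] solve the
homogeneous equation [d ^+ 2 * n%:R ^+ 2 * laplacian f = f] in the integer
variable [l], for nonzero [d] and [n]; that is,
[coshR a = 1 + 1 / (2 * d ^+ 2 * n%:R ^+ 2)]. *)
Definition dgreen_rate (R : realType) (d : R) (n : nat) : R :=
  2 * asinhR (1 / (2 * d * n%:R)).

(** Discrete Green's function of [1 - d ^+ 2 * n%:R ^+ 2 * laplacian] on the
[n]-cycle. It is written with [`|i - k|] rather than with the graph distance
[min (`|i - k|, n - `|i - k|)]: the hyperbolic cosine is even about [n / 2], so
both give the same value. *)
Definition dgreen (R : realType) (d : R) (n : nat) (i k : 'I_n) : R :=
  coshR (dgreen_rate d n * (`|i%:R - k%:R| - n%:R / 2)) /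
  (2 * d ^+ 2 * n%:R ^+ 2 * sinhR (dgreen_rate d n)
     * sinhR (dgreen_rate d n * (n%:R / 2))).

Lemma coshR_dgreen_rate (R : realType) (d : R) (n : nat) :
  coshR (dgreen_rate d n) = 1 + 2 * (1 / (2 * d * n%:R)) ^+ 2.
Proof. by rewrite coshR_double asinhRK. Qed.

Lemma sinhR_dgreen_rate (R : realType) (d : R) (n : nat) :
  sinhR (dgreen_rate d n) =
  2 * (1 / (2 * d * n%:R)) * Num.sqrt (1 + (1 / (2 * d * n%:R)) ^+ 2).
Proof. by rewrite sinhR_double asinhRK coshR_asinhR. Qed.

Lemma dgreen_rate_gt0 (R : realType) (d : R) (n : nat) :
  0 < d -> (0 < n)%N -> 0 < dgreen_rate d n.
Proof.
move=> d0 n0; rewrite mulr_gt0 // /asinhR ln_gt0 //.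
have s0 : 0 < 1 / (2 * d * n%:R) by rewrite divr_gt0 ?mulr_gt0 ?ltr0n.
set s := 1 / _ in s0 *.
have s1 : 0 <= 1 + s ^+ 2 by nra.
have q0 := sqrtr_ge0 (1 + s ^+ 2); have qE := sqr_sqrtr s1.
nra.
Qed.

(** By the evenness of [coshR], the profile of [dgreen] does not see the jump of
the cyclic successor from [n - 1] to [0]; likewise for the predecessor. *)
Lemma coshR_dist_ordS (R : realType) (a : R) (n : nat) (i k : 'I_n) :
  coshR (a * (`|(ordS i)%:R - k%:R| - n%:R / 2)) =
  coshR (a * (`|i%:R + 1 - k%:R| - n%:R / 2)).
Proof.
have [iS|] := ltnP i.+1 n; first by rewrite /= modn_small // -natr1.
move=> ni; have ni' : i.+1 = n by apply/eqP; rewrite eqn_leq ltn_ord.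
rewrite /= ni' modnn natr1 ni' sub0r normrN ger0_norm ?ler0n //.
rewrite ger0_norm ?subr_ge0 ?ler_nat ?(ltnW (ltn_ord k)) //.
by rewrite -coshRN; congr coshR; field.
Qed.

Lemma coshR_dist_ord_pred (R : realType) (a : R) (n : nat) (i k : 'I_n) :
  coshR (a * (`|(ord_pred i)%:R - k%:R| - n%:R / 2)) =
  coshR (a * (`|i%:R - 1 - k%:R| - n%:R / 2)).
Proof.
have n0 : (0 < n)%N by case: n i {k} => // -[].
have [i0|i0] := posnP i.
  rewrite /= i0 add0n modn_small ?prednK //.
  have nE : n.-1%:R = n%:R - 1 :> R by rewrite -{2}(prednK n0) -natr1 addrK.
  have kn : (k <= n.-1)%N by rewrite -ltnS prednK.
  rewrite ger0_norm ?subr_ge0 ?ler_nat //.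
  rewrite (_ : 0 - 1 - k%:R = - (1 + k%:R)) ?normrN; last by ring.
  rewrite ger0_norm ?addr_ge0 ?ler01 ?ler0n // nE.
  by rewrite -coshRN; congr coshR; field.
have iE : (i + n).-1 = (i.-1 + n)%N by rewrite -[in LHS](prednK i0).
rewrite /= iE modnDr modn_small; last by rewrite (leq_ltn_trans (leq_pred _)).
have -> : i%:R = i.-1%:R + 1 :> R by rewrite natr1 prednK.
by rewrite addrK.
Qed.

Lemma dgreen_eq (R : realType) (d : R) (n : nat) (i k : 'I_n) : 0 < d ->
  dgreen d i k - d ^+ 2 * n%:R ^+ 2 * laplacian (fun j => dgreen d j k) i
  = (i == k)%:R.
Proof.
move=> d0; have n0 : (0 < n)%N by case: n i {k} => // -[].
have nR0 : 0 < n%:R :> R by rewrite ltr0n.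
have a0 := dgreen_rate_gt0 d0 n0; have sa0 := sinhR_gt0 a0.
have san0 : 0 < sinhR (dgreen_rate d n * (n%:R / 2)).
  by rewrite sinhR_gt0 // mulr_gt0 // divr_gt0.
rewrite /laplacian /dgreen coshR_dist_ordS coshR_dist_ord_pred.
have cE := coshR_dgreen_rate d n.
set a := dgreen_rate d n in cE a0 sa0 san0 *.
have [->|neq] := eqVneq i k.
  have -> : k%:R + 1 - k%:R = 1 :> R by ring.
  have -> : k%:R - 1 - k%:R = - 1 :> R by ring.
  rewrite normrN normr1 subrr normr0 sub0r mulrN coshRN.
  rewrite [a * (1 - _)]mulrBr mulr1 coshRB cE mulr1n.
  by field; rewrite !gt_eqF.
(* As [t] is a nonzero integer, [t + 1] and [t - 1] never have the sign opposite
to that of [t]. *)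
set t : R := i%:R - k%:R.
have -> : i%:R + 1 - k%:R = t + 1 by rewrite /t; ring.
have -> : i%:R - 1 - k%:R = t - 1 by rewrite /t; ring.
set D := _ * sinhR _ * sinhR _.
have D0 : D != 0.
  rewrite (mulf_neq0 _ (lt0r_neq0 san0)) // (mulf_neq0 _ (lt0r_neq0 sa0)) //.
  by rewrite !mulf_neq0 ?expf_neq0 ?pnatr_eq0 // gt_eqF.
suff E : coshR (a * (`|t + 1| - n%:R / 2)) + coshR (a * (`|t - 1| - n%:R / 2))
    = 2 * coshR a * coshR (a * (`|t| - n%:R / 2)).
  by rewrite -[_ / D + _ / D]mulrDl E cE mulr0n; field; rewrite D0 !gt_eqF.
rewrite -coshRDB; have [ik|ki] := ltnP k i.
  have : (k.+1)%:R <= i%:R :> R by rewrite ler_nat.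
  rewrite -natr1 => ki1; rewrite !ger0_norm ?/t; try lra.
  by congr (coshR _ + coshR _); ring.
have : (i.+1)%:R <= k%:R :> R by rewrite ler_nat ltn_neqAle neq.
rewrite -natr1 => ki1; rewrite !ler0_norm ?/t; try lra.
by rewrite [LHS]addrC; congr (coshR _ + coshR _); ring.
Qed.

(** Testing the equation for [f] against [dgreen ^~ k], which a self-adjoint
Laplacian turns into a point mass at [k]; no uniqueness theorem is needed. *)
Lemma dgreen_repr (R : realType) (d : R) (n : nat) (f g : 'I_n -> R[i]) :
  0 < d ->
  (forall i, 0 = (d ^+ 2 * n%:R ^+ 2)%:C%C * laplacian f i - f i + g i) ->
  forall k, f k = \sum_i (dgreen d i k)%:C%C * g i.
Proof.
move=> d0 fg k; set c := (d ^+ 2 * n%:R ^+ 2)%:C%C.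
have gE i : g i = f i - c * laplacian f i.
  by rewrite -[RHS]addr0 [X in _ + X](fg i) -/c; ring.
pose G i := (dgreen d i k)%:C%C.
have GE i : G i - c * laplacian G i = (i == k)%:R.
  rewrite -(rmorph_nat (real_complex R)) -(dgreen_eq i k d0).
  rewrite (rmorphB (real_complex R)) [X in _ = _ - X](rmorphM (real_complex R)).
  rewrite /laplacian (rmorphB (real_complex R)) (rmorphD (real_complex R)).
  by rewrite (rmorphMn (real_complex R)).
under eq_bigr => i _ do rewrite gE mulrBr (mulrCA _ c) (mulrC _ (laplacian f i)).
rewrite sumrB -mulr_sumr laplacian_self_adjoint mulr_sumr -sumrB.
under eq_bigr => i _ do rewrite mulrC mulrCA -mulrBr -/(G i) GE.
rewrite (bigD1 k) //= eqxx mulr1 big1 ?addr0 // => i /negbTE ->.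
by rewrite mulr0.
Qed.

(** * Reduction of the eigenvalue problem to the spikes *)

(** The matrix of the linearized dynamics on the spikes, obtained by eliminating
[psi]; its size is [K] whatever the number of nodes. *)
Definition spike_mx (R : realType) (d : R) (n K : nat)
    (p : 'I_K -> 'I_n) (u : 'I_n -> R) : 'M[R]_K :=
  1%:M - \matrix_(k, j) (2 * u (p j) * dgreen d (p j) (p k)).

(** The values of [phi] on the spikes form a column eigenvector of [spike_mx]:
they cannot all vanish, for then [phi], and so [psi], would vanish everywhere. *)
Lemma linearized_eigenvalue_spike (R : realType) (d : R) (n K : nat)
    (p : 'I_K -> 'I_n) (u v : 'I_n -> R) (lam : R[i]) :
  0 < d -> spike_solution d p u v -> linearized_eigenvalue d u v lam ->
  lam != -1 ->
  exists2 f : 'I_K -> R[i], (exists k, f k != 0) &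
    forall k, lam * f k = \sum_j (spike_mx d p u k j)%:C%C * f j.
Proof.
move=> d0 [p_inj _ uv u0] [phi [psi [nz eqs]]] lamN1.
have phi0 i : (forall k, i != p k) -> phi i = 0.
  move=> ip; have := (eqs i).1; rewrite u0 // mulr0 expr0n /= !mul0r.
  rewrite addr0 subr0 => /eqP.
  rewrite -subr_eq0 opprK -[X in _ + X]mul1r -mulrDl mulf_eq0 addr_eq0.
  by rewrite (negbTE lamN1) => /eqP.
have psiE k : psi k = \sum_j (2 * u (p j) * dgreen d (p j) k)%:C%C * phi (p j).
  rewrite (dgreen_repr d0 (fun i => (eqs i).2)).
  transitivity (\sum_(i in [set p j | j : 'I_K])
     (dgreen d i k)%:C%C * ((2 * u i)%:C%C * phi i)).
    rewrite [RHS]big_mkcond /=; apply: eq_bigr => i _; case: ifP => // /negP ip.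
    rewrite phi0 ?mulr0 // => j; apply/eqP => ij; apply: ip.
    by rewrite ij; apply/imsetP; exists j.
  rewrite big_imset /=; last by move=> i j _ _; apply: p_inj.
  apply: eq_big => [j|j _]; rewrite ?inE // mulrA -rmorphM.
  by rewrite [_ * (2 * _)]mulrC.
exists (phi \o p) => [|k] /=; last first.
  rewrite (eqs (p k)).1.
  have [up0 ukv] := uv k; have vk0 : v (p k) != 0 by rewrite -up0 gt_eqF.
  have -> : 2 * u (p k) / v (p k) = 2 by rewrite up0 mulfK.
  have -> : u (p k) ^+ 2 / v (p k) ^+ 2 = 1 by rewrite up0 divff ?expf_neq0.
  rewrite psiE rmorph1 rmorph_nat mul1r.
  have -> : - phi (p k) + 2 * phi (p k) = phi (p k) by ring.
  under [RHS]eq_bigr => j _ do rewrite !mxE rmorphB mulrBl.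
  rewrite sumrB; congr (_ - _).
  rewrite (bigD1 k) //= eqxx rmorph1 mul1r big1 ?addr0 // => j.
  by rewrite eq_sym => /negbTE ->; rewrite mulr0n rmorph0 mul0r.
have [i nzi] := nz; apply: contrapT => f0.
have fk k : phi (p k) = 0.
  by apply/eqP/negPn/negP => fk; apply: f0; exists k.
have phi_i j : phi j = 0.
  have [[k ->] //|jp] := pselect (exists k, j = p k).
  by apply: phi0 => k; apply/eqP => jk; apply: jp; exists k.
have psi_i : psi i = 0.
  by rewrite psiE big1 // => j _; rewrite fk mulr0.
by move: nzi; rewrite phi_i psi_i eqxx.
Qed.

(** * Convergence of the discrete Green's function *)

Lemma coshR_circle_dist (R : realType) (c y z : R) :
  coshR (c * (circle_dist y z - 1 / 2)) = coshR (c * (`|y - z| - 1 / 2)).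
Proof.
rewrite /circle_dist; case: leP => // _; rewrite -coshRN; congr coshR; lra.
Qed.

Lemma circle_distC (R : realType) (y z : R) : circle_dist y z = circle_dist z y.
Proof. by rewrite /circle_dist distrC. Qed.

(** The bounds on the arguments matter: [circle_dist] is the distance of the
circle only for representatives at most [1] apart. *)
Lemma circle_dist_triangle (R : realType) (y w z : R) :
  0 <= y < 1 -> 0 <= w < 1 -> 0 <= z < 1 ->
  circle_dist y z <= circle_dist y w + circle_dist w z.
Proof.
move=> /andP[y0 y1] /andP[w0 w1] /andP[z0 z1].
rewrite /circle_dist.
set m := Num.min `|y - z| _.
have m1 : m <= `|y - z| by rewrite ge_min lexx.
have m2 : m <= 1 - `|y - z| by rewrite ge_min lexx orbT.
move: m1 m2; case: (leP `|y - w|); case: (leP `|w - z|).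
all: case: (ger0P (y - z)); case: (ger0P (y - w)); case: (ger0P (w - z)) => *.
all: lra.
Qed.

Lemma circle_dist_quad (R : realType) (y y' z z' : R) :
  0 <= y < 1 -> 0 <= y' < 1 -> 0 <= z < 1 -> 0 <= z' < 1 ->
  `|circle_dist y' z' - circle_dist y z| <= circle_dist y' y + circle_dist z' z.
Proof.
move=> y1 y1' z1 z1'.
have := circle_dist_triangle y1 y1' z1; have := circle_dist_triangle y1' z1' z1.
have := circle_dist_triangle y1' y1 z1'; have := circle_dist_triangle y1 z1 z1'.
rewrite (circle_distC y y') (circle_distC z z') ler_norml => *.
by apply/andP; split; lra.
Qed.

Lemma node_pos_bounds (R : realType) (n : nat) (i : 'I_n) :
  0 <= node_pos R i < 1.
Proof.
have n0 : 0 < n%:R :> R by rewrite ltr0n; case: n i => // -[].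
by rewrite /node_pos divr_ge0 //= ltr_pdivrMr // mul1r ltr_nat.
Qed.

(** The representatives [Y m] may fail to converge in the line (when [y = 0] they
may jump between values near [0] and values near [1]); only their circle
distances to [y] tend to [0]. *)
Lemma cvg_circle_dist (R : realType) (y z : R) (Y Z : nat -> R) :
  0 <= y < 1 -> 0 <= z < 1 ->
  (forall m, 0 <= Y m < 1) -> (forall m, 0 <= Z m < 1) ->
  circle_dist (Y m) y @[m --> \oo] --> (0 : R) ->
  circle_dist (Z m) z @[m --> \oo] --> (0 : R) ->
  circle_dist (Y m) (Z m) @[m --> \oo] --> circle_dist y z.
Proof.
move=> y1 z1 Y1 Z1 Yy Zz; apply/cvgrPdist_le => e e0.
have /cvgrPdist_le/(_ _ e0) : circle_dist (Y m) y + circle_dist (Z m) z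
    @[m --> \oo] --> (0 + 0 : R) by apply: cvgD.
apply: filterS => m; rewrite addr0 sub0r normrN => h.
rewrite distrC.
by apply: le_trans (circle_dist_quad _ _ _ _) (le_trans (ler_norm _) h).
Qed.

Lemma cvg_dgreen (R : realType) (d : R) (N : nat -> nat)
    (a b : forall m, 'I_(N m)) (y z : R) :
  0 < d -> N m @[m --> \oo] --> \oo ->
  0 <= y < 1 -> 0 <= z < 1 ->
  circle_dist (node_pos R (a m)) y @[m --> \oo] --> (0 : R) ->
  circle_dist (node_pos R (b m)) z @[m --> \oo] --> (0 : R) ->
  (N m)%:R * dgreen d (a m) (b m) @[m --> \oo] --> Gper d y z.
Proof.
move=> d0 hN y1 z1 ay bz.
have N0 m : 0 < (N m)%:R :> R by rewrite ltr0n; case: (N m) (a m) => // -[].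
pose s m : R := 1 / (2 * d * (N m)%:R).
have s0 m : 0 < s m by rewrite divr_gt0 ?mulr_gt0.
have scvg : s m @[m --> \oo] --> (0 : R).
  have -> : s = fun m => (2 * d)^-1 * ((N m)%:R)^-1.
    by apply/funext => m; rewrite /s mul1r invfM.
  rewrite -(mulr0 (2 * d)^-1); apply: cvgM; first exact: cvg_cst.
  apply/gtr0_cvgV0; first exact: nearW.
  exact: (cvg_comp _ _ hN (@cvgr_idn R)).
pose w m : R := dgreen_rate d (N m) * (N m)%:R.
have wcvg : w m @[m --> \oo] --> d^-1.
  have -> : w = fun m => asinhR (s m) / s m * d^-1.
    apply/funext => m; rewrite /w /dgreen_rate -/(s m).
    by rewrite {3}/s; field; rewrite !gt_eqF.
  rewrite -[X in _ --> X]mul1r; apply: cvgMr_tmp; exact: cvg_asinhR_ratio.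
pose q m : R := (N m)%:R * sinhR (dgreen_rate d (N m)).
have qcvg : q m @[m --> \oo] --> d^-1.
  have -> : q = fun m => Num.sqrt (1 + s m ^+ 2) * d^-1.
    apply/funext => m; rewrite /q sinhR_dgreen_rate -/(s m).
    by rewrite {1}/s; field; rewrite !gt_eqF.
  rewrite -[X in _ --> X]mul1r; apply: cvgMr_tmp.
  rewrite -[X in _ --> X]sqrtr1.
  apply: (continuous_cvg _ (@sqrt_continuous R _)).
  rewrite -[X in _ --> X]addr0; apply: cvgD; first exact: cvg_cst.
  by rewrite -(mulr0 0); apply: cvgM.
pose c m := circle_dist (node_pos R (a m)) (node_pos R (b m)).
have ccvg : c m @[m --> \oo] --> circle_dist y z.
  by apply: cvg_circle_dist => // m; apply: node_pos_bounds.
have -> : (fun m => (N m)%:R * dgreen d (a m) (b m)) =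
    fun m => coshR (w m * (c m - 1 / 2)) *
       (2 * d ^+ 2 * q m * sinhR (w m * (1 / 2)))^-1.
  apply/funext => m; have rate0 : 0 < dgreen_rate d (N m).
    by rewrite dgreen_rate_gt0 // -(ltr0n R).
  have sa0 := sinhR_gt0 rate0.
  have -> : w m * (1 / 2) = dgreen_rate d (N m) * ((N m)%:R / 2).
    by rewrite /w; ring.
  have san0 : 0 < sinhR (dgreen_rate d (N m) * ((N m)%:R / 2)).
    by rewrite sinhR_gt0 // mulr_gt0 // divr_gt0.
  rewrite /c coshR_circle_dist /dgreen /q.
  have -> : w m * (`|node_pos R (a m) - node_pos R (b m)| - 1 / 2) =
      dgreen_rate d (N m) * (`|(a m)%:R - (b m)%:R| - (N m)%:R / 2).
    rewrite /node_pos -mulrBl normrM (gtr0_norm (x := _^-1)) ?invr_gt0 // /w.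
    by field; rewrite gt_eqF.
  by field; rewrite !gt_eqF.
have -> : Gper d y z = coshR (d^-1 * (circle_dist y z - 1 / 2)) *
    (2 * d ^+ 2 * d^-1 * sinhR (d^-1 * (1 / 2)))^-1.
  have e1 : d^-1 * (1 / 2) = 1 / (2 * d) by field; rewrite gt_eqF.
  have sd0 : 0 < sinhR (1 / (2 * d)) by rewrite sinhR_gt0 // divr_gt0 ?mulr_gt0.
  by rewrite /Gper e1 [d^-1 * _]mulrC; field; rewrite !gt_eqF.
apply: cvgM.
  apply: (continuous_cvg _ (@continuous_coshR R _)).
  by apply: cvgM => //; apply: cvgB => //; apply: cvg_cst.
apply: cvgV.
  have sd0 : 0 < sinhR (d^-1 * (1 / 2)).
    by rewrite sinhR_gt0 // mulr_gt0 ?invr_gt0.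
  apply: mulf_neq0; last exact: lt0r_neq0.
  by rewrite !mulf_neq0 ?expf_neq0 ?invr_neq0 ?(lt0r_neq0 d0) ?pnatr_eq0.
apply: cvgM; last first.
  apply: (continuous_cvg _ (@continuous_sinhR R _)).
  exact: cvgMr_tmp.
by apply: cvgM => //; apply: cvg_cst.
Qed.

(** * Continuity of the eigenvalues of a matrix *)

Lemma ler_dist_prod (F : numDomainType) (n : nat) (a b : 'I_n -> F) (c e : F) :
  1 <= c -> (forall i, `|a i| <= c) -> (forall i, `|b i| <= c) ->
  (forall i, `|a i - b i| <= e) ->
  `|\prod_i a i - \prod_i b i| <= n%:R * c ^+ n * e.
Proof.
move=> c1; have c0 : 0 <= c := le_trans ler01 c1.
elim: n a b => [|n IHn] a b ac bc abe.
  by rewrite !big_ord0 subrr normr0 !mul0r.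
rewrite !big_ord_recl.
set A := \prod_(i < n) _; set B := \prod_(i < n) b _.
have AB : `|A - B| <= n%:R * c ^+ n * e by apply: IHn.
have e0 : 0 <= e := le_trans (normr_ge0 _) (abe ord0).
have An : `|A| <= c ^+ n.
  rewrite normr_prod -[n in c ^+ n]card_ord -prodr_const.
  by apply: ler_prod => i _; rewrite normr_ge0 ac.
have -> : a ord0 * A - b ord0 * B
    = (a ord0 - b ord0) * A + b ord0 * (A - B) by ring.
have -> : n.+1%:R * c ^+ n.+1 * e = e * c ^+ n.+1 + c * (n%:R * c ^+ n * e).
  by rewrite -natr1 exprS; ring.
apply: (le_trans (ler_normD _ _)); rewrite !normrM lerD //.
  apply: ler_pM => //; apply: (le_trans An).
  by rewrite exprS ler_peMl ?exprn_ge0.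
exact: ler_pM.
Qed.

Lemma ler_dist_det (F : numDomainType) (n : nat) (A B : 'M[F]_n) (c e : F) :
  1 <= c -> (forall i j, `|A i j| <= c) -> (forall i j, `|B i j| <= c) ->
  (forall i j, `|A i j - B i j| <= e) ->
  `|\det A - \det B| <= n`!%:R * (n%:R * c ^+ n * e).
Proof.
move=> c1 Ac Bc ABe; rewrite /determinant -sumrB.
apply: (le_trans (ler_norm_sum _ _ _)).
rewrite mulr_natl -card_Sn -sumr_const; apply: ler_sum => s _.
rewrite -mulrBr normrM normrX normrN1 expr1n mul1r.
exact: ler_dist_prod.
Qed.

Lemma ler_norm_eigen (F : numDomainType) (n : nat) (A : 'M[F]_n) (c lam : F)
    (f : 'I_n -> F) :
  (forall i j, `|A i j| <= c) -> (exists i, f i != 0) ->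
  (forall i, lam * f i = \sum_j A i j * f j) ->
  `|lam| <= n%:R * c.
Proof.
move=> Ac [i0 fi0] lamf.
have s0 : 0 < \sum_i `|f i|.
  rewrite lt_def sumr_ge0 ?andbT // psumr_eq0 //; apply/allPn.
  by exists i0; rewrite ?mem_index_enum //= normr_eq0.
rewrite -(ler_pM2r s0) mulr_sumr.
apply: (@le_trans _ _ (\sum_(i < n) \sum_(j < n) c * `|f j|)).
  apply: ler_sum => i _; rewrite -normrM lamf.
  apply: (le_trans (ler_norm_sum _ _ _)); apply: ler_sum => j _.
  by rewrite normrM ler_wpM2r.
by rewrite sumr_const card_ord -mulr_sumr -mulrA mulr_natl.
Qed.

Lemma det_eigen0 (F : fieldType) (n : nat) (A : 'M[F]_n) (lam : F)
    (f : 'I_n -> F) :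
  (exists i, f i != 0) -> (forall i, lam * f i = \sum_j A i j * f j) ->
  \det (lam%:M - A) = 0.
Proof.
move=> [i0 fi0] lamf; apply/eqP; rewrite -det_tr; apply/det0P.
exists (\row_j f j).
  by apply: contra fi0 => /eqP/rowP/(_ i0); rewrite !mxE => ->.
apply/rowP => i; rewrite !mxE.
under eq_bigr => j _ do rewrite !mxE mulrBr.
rewrite sumrB (bigD1 i) //= eqxx mulr1n big1 ?addr0; last first.
  by move=> j; rewrite eq_sym => /negbTE ->; rewrite mulr0n mulr0.
rewrite mulrC lamf; apply/eqP; rewrite subr_eq0; apply/eqP.
by apply: eq_bigr => j _; rewrite mulrC.
Qed.

Lemma char_poly_roots (F : closedFieldType) (n : nat) (A : 'M[F]_n) :
  exists r : seq F, [/\ size r = n, (forall z, z \in r -> eigenvalue A z) &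
    forall lam, \det (lam%:M - A) = \prod_(z <- r) (lam - z)].
Proof.
have [r] := closed_field_poly_normal (char_poly A).
rewrite (monicP (char_poly_monic A)) scale1r => rE; exists r; split.
- by have := size_char_poly A; rewrite rE size_prod_XsubC => -[].
- by move=> z zr; rewrite eigenvalue_root_char rE root_prod_XsubC.
move=> lam; have -> : \prod_(z <- r) (lam - z) = (char_poly A).[lam].
  rewrite rE horner_prod; apply: eq_bigr => z _.
  by rewrite hornerXsubC.
rewrite /char_poly -horner_evalE -det_map_mx; congr (\det _).
apply/matrixP => i j; rewrite !mxE /= horner_evalE hornerD hornerN hornerMn.
by rewrite hornerX hornerC.
Qed.

(** The eigenvalue problem for [B] is stated with column vectors, as it arises
from the linearized system. The finite list [r] of eigenvalues of [A] does not
depend on [e], so that [e] may be chosen according to its distance to the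
imaginary axis. *)
Lemma eigenvalue_perturbation (R : realType) (n : nat) (A : 'M[R]_n) :
  exists2 r : seq R[i], (forall z, z \in r -> complex_eigenvalue A z) &
  forall e : R, 0 < e -> exists2 del : R, 0 < del &
    forall B : 'M[R]_n, (forall i j, `|A i j - B i j| <= del) ->
    forall (lam : R[i]) (f : 'I_n -> R[i]),
      (exists i, f i != 0) ->
      (forall i, lam * f i = \sum_j (B i j)%:C%C * f j) ->
      exists2 z, z \in r & complex.Re lam < complex.Re z + e.
Proof.
have [r [sr rA detA]] := char_poly_roots (map_mx (real_complex R) A).
exists r => // e e0.
have nrm (t : R) : `|t%:C%C| = `|t|%:C%C.
  by rewrite normc_def /= expr0n /= addr0 sqrtr_sqr.
(* [c] bounds the entries of [A] and of every [B] entrywise within [1] of [A]. *)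
pose c := 1 + \sum_i \sum_j `|A i j|.
have A_c i j : `|A i j| + 1 <= c.
  rewrite addrC lerD2l (bigD1 i) //= (bigD1 j) //= -addrA lerDl.
  by rewrite addr_ge0 ?sumr_ge0 // => k _; rewrite sumr_ge0.
have c1 : 1 <= c by rewrite lerDl sumr_ge0 // => i _; rewrite sumr_ge0.
(* [c'] bounds the entries of [lam%:M - A] and of [lam%:M - B], as
[`|lam| <= n%:R * c]. *)
pose c' := n%:R * c + c.
have c'1 : 1 <= c' by rewrite (le_trans c1) // lerDr mulr_ge0 ?ler0n //; lra.
(* Lipschitz constant of the determinant, for the entrywise distance, on matrices
with entries bounded by [c']. *)
pose L := n`!%:R * (n%:R * c' ^+ n).
have L0 : 0 <= L by rewrite !mulr_ge0 ?ler0n ?exprn_ge0 //; lra.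
pose del := Num.min 1 (e ^+ n / (L + 1)).
have L1 : 0 < L + 1 by lra.
have del0 : 0 < del by rewrite lt_min ltr01 divr_gt0 ?exprn_gt0.
exists del => // B AB lam f f0 lamf.
have B_c i j : `|B i j| <= c.
  rewrite (le_trans _ (A_c i j)) // -[B i j](subKr (A i j)).
  rewrite (le_trans (ler_normB _ _)) // lerD2l (le_trans (AB i j)) //.
  by rewrite ge_min lexx.
have lam_c : `|lam| <= (n%:R * c)%:C%C.
  rewrite rmorphM rmorph_nat.
  apply: (@ler_norm_eigen _ _ (map_mx (real_complex R) B)) f0 _.
    by move=> i j; rewrite mxE nrm lecR.
  by move=> i; rewrite lamf; apply: eq_bigr => j _; rewrite mxE.
have entry_c (C : 'M[R]_n) i j : (forall i j, `|C i j| <= c) ->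
    `|(lam%:M - map_mx (real_complex R) C) i j| <= c'%:C%C.
  move=> Cc; rewrite !mxE /c' rmorphD (le_trans (ler_normB _ _)) // lerD //.
    by case: (i == j); rewrite ?mulr1n // mulr0n normr0 lecR mulr_ge0 //; lra.
  by rewrite nrm lecR.
have detB : \det (lam%:M - map_mx (real_complex R) B) = 0.
  apply: det_eigen0 f0 _ => i.
  by rewrite lamf; apply: eq_bigr => j _; rewrite mxE.
have small : `|\prod_(z <- r) (lam - z)| <= (L * del)%:C%C.
  rewrite -detA -[X in `|X|]subr0 -detB /L -!mulrA !rmorphM !rmorph_nat rmorphXn.
  rewrite [n%:R * (_ * _)]mulrA.
  apply: ler_dist_det.
  - by rewrite -(rmorph1 (real_complex R)) lecR.
  - by move=> i j; apply: entry_c => {}i {}j; have := A_c i j; lra.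
  - by move=> i j; apply: entry_c.
  have subKA (y a b : R[i]) : y - a - (y - b) = b - a by ring.
  by move=> i j; rewrite !mxE subKA -rmorphB nrm lecR distrC.
apply: contrapT => far.
(* Otherwise each of the [n] factors [lam - z] has norm at least [e]. *)
have big : (e ^+ n)%:C%C <= `|\prod_(z <- r) (lam - z)|.
  rewrite normr_prod -sr rmorphXn /= big_tnth -[X in _ ^+ X]card_ord -prodr_const.
  apply: ler_prod => i _; rewrite lecR (ltW e0) /=.
  apply: le_trans (normc_ge_Re _); rewrite lecR.
  rewrite (le_trans _ (ler_norm _)) // leNgt; apply/negP => near_z; apply: far.
  exists (tnth (in_tuple r) i); first exact: mem_tnth.
  by move: near_z; rewrite raddfB /=; lra.
have := le_trans big small; rewrite lecR leNgt => /negP[].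
have en0 : 0 < e ^+ n by rewrite exprn_gt0.
apply: (@le_lt_trans _ _ (L * (e ^+ n / (L + 1)))).
  by rewrite ler_wpM2l // ge_min lexx orbT.
by rewrite mulrA ltr_pdivrMr //; nra.
Qed.

(** * Stability of the spike solutions *)

Lemma cvg_spike_mx (R : realType) (d : R) (K : nat)
    (x V : 'I_K -> R) (N : nat -> nat) (p : forall m, 'I_K -> 'I_(N m))
    (u v : forall m, 'I_(N m) -> R) :
  0 < d -> (forall k, 0 <= x k < 1) -> (forall k, 0 < V k) ->
  N m @[m --> \oo] --> \oo -> leading_order_profile d x V p u v ->
  forall k j, spike_mx d (p m) (u m) k j @[m --> \oo]
    --> (1%:M - Mmx d x V) k j.
Proof.
move=> d0 hx hV hN [px uV _] k j.
have -> : (fun m => spike_mx d (p m) (u m) k j) = fun m => (1%:M : 'M[R]_K) k j -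
    2 * V j * (u m (p m j) / ((N m)%:R * V j))
      * ((N m)%:R * dgreen d (p m j) (p m k)).
  apply/funext => m; rewrite !mxE; congr (_ - _).
  have N0 : 0 < (N m)%:R :> R by rewrite ltr0n; case: (N m) (p m k) => // -[].
  by have Vj := hV j; field; rewrite !gt_eqF.
have -> : (1%:M - Mmx d x V) k j = (1%:M : 'M[R]_K) k j -
    2 * V j * 1 * Gper d (x j) (x k).
  by rewrite !mxE mulr1 /Gper (circle_distC (x k)).
apply: cvgB; first exact: cvg_cst.
apply: cvgM; last exact: cvg_dgreen.
by apply: cvgM => //; exact: cvg_cst.
Qed.

Lemma uniform_lt0 (R : realType) (T : eqType) (f : T -> R) (r : seq T) :
  (forall z, z \in r -> f z < 0) ->
  exists2 e : R, 0 < e & forall z, z \in r -> f z + e <= 0.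
Proof.
elim: r => [|z r IHr] fr; first by exists 1.
have [|e e0 er] := IHr; first by move=> y yr; apply: fr; rewrite inE yr orbT.
have fz : f z < 0 by apply: fr; rewrite mem_head.
exists (Num.min e (- f z)) => [|y]; first by rewrite lt_min e0 oppr_gt0.
rewrite inE -lerBrDl sub0r ge_min => /orP[/eqP ->|/er].
  by rewrite lexx orbT.
by move=> ey; apply/orP; left; lra.
Qed.

Theorem mainTheorem2 (R : realType) (d : R) (hd : 0 < d)
    (K : nat) (hK : (0 < K)%N)
    (x V : 'I_K -> R)
    (hx : forall k, 0 <= x k < 1) (x_inj : injective x)
    (hV : forall k, 0 < V k)
    (VE : forall k, V k = \sum_(j < K) V j ^+ 2 * Gper d (x k) (x j))
    (N : nat -> nat) (hN : N m @[m --> \oo] --> \oo)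
    (p : forall m, 'I_K -> 'I_(N m))
    (u v : forall m, 'I_(N m) -> R)
    (huv : forall m, spike_solution d (p m) (u m) (v m))
    (hprofile : leading_order_profile d x V p u v)
    (hM : forall z : R[i],
        complex_eigenvalue (1%:M - Mmx d x V) z -> complex.Re z <= 0) :
  stable_to_leading_order d u v /\
  ((forall z : R[i],
      complex_eigenvalue (1%:M - Mmx d x V) z -> complex.Re z != 0) ->
   \forall m \near \oo, stable d (u m) (v m)).
Proof.
have [r rA near_r] := eigenvalue_perturbation (1%:M - Mmx d x V).
have close (e : R) : 0 < e -> \forall m \near \oo, forall lam : R[i],
    linearized_eigenvalue d (u m) (v m) lam ->
    lam = -1 \/ exists2 z, z \in r & complex.Re lam < complex.Re z + e.
  move=> e0; have [del del0 pert] := near_r e e0.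
  have : \forall m \near \oo, forall ij : 'I_K * 'I_K,
      `|(1%:M - Mmx d x V) ij.1 ij.2 - spike_mx d (p m) (u m) ij.1 ij.2| <= del.
    apply: filter_forall => ij.
    have /cvgrPdist_le := @cvg_spike_mx _ _ _ _ _ _ _ _ _ hd hx hV hN hprofile
      ij.1 ij.2.
    by apply.
  apply: filterS => m near_m lam lam_eig.
  have [->|lamN1] := eqVneq lam (-1); [by left | right].
  have [f f0 fE] := linearized_eigenvalue_spike hd (huv m) lam_eig lamN1.
  apply: pert f0 fE => i j.
  exact: near_m (i, j).
have ReN1 : complex.Re (-1 : R[i]) = -1 by [].
split=> [e e0|hM0].
  apply: filterS (close e e0) => m near_m lam /near_m[->|[z /rA/hM z0 lam_z]].
    by rewrite ReN1; lra.
  by lra.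
have [e e0 re] :
    exists2 e : R, 0 < e & forall z, z \in r -> complex.Re z + e <= 0.
  by apply: uniform_lt0 => z /rA zA; rewrite lt_neqAle hM0 ?hM.
apply: filterS (close e e0) => m near_m lam /near_m[->|[z /re ze lam_z]].
  by rewrite ReN1; lra.
by lra.
Qed.
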